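(* Let $(P,w)$ be a naturally labeled poset with $n$ elements. Then $$K_P(\mathbf x)=\sum_{\alpha\vDash n}\frac{\Psi_\alpha(\mathbf x)}{z_\alpha}\,|\mathcal L^*_\alpha(P,w)|.$$ In particular $K_P$ is $\Psi$-positive, i.e. has nonnegative coefficients in the basis $\{\Psi_\alpha\}$.
   Context: Compositions: $\alpha=(\alpha_1,\dots,\alpha_\ell)\vDash n$, $S_\alpha=\{\alpha_1,\dots,\alpha_1+\dots+\alpha_{\ell-1}\}$, blocks $B_i(\alpha)=\{\alpha_1+\dots+\alpha_{i-1}+1,\dots,\alpha_1+\dots+\alpha_i\}$, $\alpha\le\beta$ iff $S_\beta\subseteq S_\alpha$. $K_P(\mathbf x)=\sum_f\prod_{x\in P}x_{f(x)}$ over all maps $f:P\to\mathbb Z_{>0}$ with $x<_Py\Rightarrow f(x)\le f(y)$. $M_\alpha=\sum_{i_1<\dots<i_\ell}x_{i_1}^{\alpha_1}\cdots x_{i_\ell}^{\alpha_\ell}$; $z_\alpha=\prod_i i^{m_i}m_i!$ ($m_i$ = number of parts equal to $i$); $\pi(\gamma)=\prod_{i}(\gamma_1+\dots+\gamma_i)$; for $\alpha\le\beta$, $\pi(\alpha,\beta)=\prod_{i=1}^{\ell(\beta)}\pi(\alpha^{(i)})$ with $\alpha^{(i)}$ the parts $\alpha_j$ with $B_j(\alpha)\subseteq B_i(\beta)$; $\Psi_\alpha=z_\alpha\sum_{\beta\ge\alpha}\pi(\alpha,\beta)^{-1}M_\beta$. A labeled poset $(P,w)$ is a finite poset with a bijection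 $w:P\to[n]$, naturally labeled if $x<_Py\Rightarrow w(x)<w(y)$. $\mathcal L(P,w)=\{\sigma\in\mathfrak S_n:\sigma^{-1}(w(x))<\sigma^{-1}(w(y))\text{ whenever }x<_Py\}$. $\sigma\in\mathfrak S_n$ is $\alpha$-unimodal if on each block $[a,b]=B_i(\alpha)$ one has $\sigma_a>\dots>\sigma_k<\dots<\sigma_b$ for some $k$. $P_i^\alpha(\sigma)=\{w^{-1}(\sigma_j):j\in B_i(\alpha)\}$ with induced order. $\mathcal L^*_\alpha(P,w)$ is the set of $\alpha$-unimodal $\sigma\in\mathcal L(P,w)$ such that each $P_i^\alpha(\sigma)$ has a unique minimal element. *)

(* Defs.v *)
From HB Require Import structures.
From mathcomp Require Import all_boot all_order all_algebra all_fingroup.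
Set Implicit Arguments. Unset Strict Implicit. Unset Printing Implicit Defensive.
Import GRing.Theory Num.Theory.

(* Conventions: positions and values are 0-based ('I_n stands for [n]);
   variable index i : 'I_k stands for x_{i+1}.  A monomial x^e is encoded
   by its finite exponent sequence e = (e_0,...,e_{k-1}) (exponent of x_{i+1}
   is nth 0 e i, exponents of later variables are 0).  Equality of formal
   power series is equality of all monomial coefficients. *)

Definition is_comp (n : nat) (a : seq nat) : bool :=
  all (fun k => 0 < k) a && (sumn a == n).

Definition psum (a : seq nat) (i : nat) : nat := sumn (take i a).

Definition Sset (a : seq nat) : seq nat :=
  [seq psum a i | i <- iota 1 (size a).-1].

Definition comp_le (a b : seq nat) : bool :=
  all (fun s => s \in Sset a) (Sset b).

(* 0-based position j lies in the (0-based) i-th block B_{i+1}(a) *)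
Definition in_block (a : seq nat) (i j : nat) : bool :=
  (psum a i <= j) && (j < psum a i.+1).

Definition sub_block (a b : seq nat) (j i : nat) : bool :=
  (psum b i <= psum a j) && (psum a j.+1 <= psum b i.+1).

Definition pi_comp (g : seq nat) : nat := \prod_(i < size g) psum g i.+1.

Definition restr (a b : seq nat) (i : nat) : seq nat :=
  [seq nth 0 a j | j <- iota 0 (size a) & sub_block a b j i].

Definition pi_pair (a b : seq nat) : nat :=
  \prod_(i < size b) pi_comp (restr a b i).

Definition zee (a : seq nat) : nat :=
  \prod_(1 <= i < (sumn a).+1) (i ^ count_mem i a * (count_mem i a)`!).

(* sum over all compositions alpha of n (each composition has length <= n
   and parts <= n, so it appears exactly once) *)
Definition sum_comps (n : nat) (F : seq nat -> rat) : rat :=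
  (\sum_(k < n.+1) \sum_(t : k.-tuple 'I_n.+1 | is_comp n [seq val i | i <- t])
      F [seq val i | i <- t])%R.

(* coefficient of x^e in M_beta: number of i_1 < ... < i_l with
   x_{i_1}^{b_1} ... x_{i_l}^{b_l} = x^e *)
Definition coefMon (b e : seq nat) : nat :=
  #|[set t : (size b).-tuple 'I_(size e) |
       sorted (fun x y : nat => x < y) [seq val i | i <- t] &
       [forall j : 'I_(size e),
          nth 0 e j == (if j \in t then nth 0 b (index j t) else 0)]]|.

Definition coefPsiA (n : nat) (a e : seq nat) : rat :=
  ((zee a)%:R * sum_comps n (fun b =>
      if comp_le a b then ((pi_pair a b)%:R)^-1 * (coefMon b e)%:R else 0))%R.

Definition coefKP (T : finType) (le : rel T) (e : seq nat) : nat :=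
  #|[set f : {ffun T -> 'I_(size e)} |
       [forall x, forall y, le x y ==> (f x <= f y)] &
       [forall i : 'I_(size e), #|[set x | f x == i]| == nth 0 e i]]|.

Definition lin_ext (n : nat) (T : finType) (le : rel T) (w : T -> 'I_n)
    (s : 'S_n) : bool :=
  [forall x, forall y, (le x y && (x != y)) ==>
     ((s^-1)%g (w x) < (s^-1)%g (w y))].

Definition word (n : nat) (s : 'S_n) : seq nat := [seq val (s i) | i <- enum 'I_n].

Definition unimodal_on (u : seq nat) (lo hi : nat) : bool :=
  [exists k : 'I_hi, (lo <= k) &&
     [forall j : 'I_hi, ((lo <= j) && (j.+1 < hi)) ==>
        (((j.+1 <= k) ==> (nth 0 u j.+1 < nth 0 u j)) &&
         ((k <= j) ==> (nth 0 u j < nth 0 u j.+1)))]].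

Definition alpha_unimodal (n : nat) (a : seq nat) (s : 'S_n) : bool :=
  all (fun i => unimodal_on (word s) (psum a i) (psum a i.+1)) (iota 0 (size a)).

Definition blockP (n : nat) (T : finType) (w : T -> 'I_n) (a : seq nat)
    (s : 'S_n) (i : nat) : {set T} :=
  [set x | [exists j : 'I_n, in_block a i j && (s j == w x)]].

Definition unique_min (T : finType) (le : rel T) (A : {set T}) : bool :=
  #|[set x in A | [forall y in A, le y x ==> (y == x)]]| == 1.

Definition Lstar (n : nat) (T : finType) (le : rel T) (w : T -> 'I_n)
    (a : seq nat) : nat :=
  #|[set s : 'S_n | [&& lin_ext le w s, alpha_unimodal a s &
       [forall i : 'I_(size a), unique_min le (blockP w a s i)]]]|.

(* Main.v *)
Require Import Defs.
From HB Require Import structures.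
From mathcomp Require Import all_boot all_order all_algebra all_fingroup.
From mathcomp Require Import zify.
Import GRing.Theory Num.Theory.
Set Implicit Arguments. Unset Strict Implicit. Unset Printing Implicit Defensive.

(** A block of a starred linear extension starts with its minimum, hence with its
    smallest label, so unimodality forces it to increase.  A starred linear
    extension is therefore the same thing as an order-preserving map onto the
    blocks whose fibres have the sizes [alpha] and each have a minimum: list [P]
    by block, and by label inside a block.  The last fibre of such a map is a
    principal filter of [P].

    Let [N(P, beta)] count the order-preserving maps with fibre sizes [beta],
    that is, the coefficient of [M_beta] in [K_P], and let [c] be the last part of
    [beta].  Counting pairs of a map and an element [x] of its last fibre gives
    [c N(P, beta) = sum_x N(P - V_x, beta^x)], where [V_x] is the filter of [x] and
    [beta^x] is [beta] with its last part lowered by [|V_x|].  The sum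
    [sum_(alpha <= beta) |L*_alpha| / pi(alpha, beta)] satisfies the same
    recursion, because deleting the last block of [alpha] divides [pi(alpha, beta)]
    by [c]. *)

(** * Order-preserving maps counted fibre by fibre *)

Section FibreCount.
Variables (T : finType) (le : rel T).
Implicit Types (D U : {set T}) (Q : pred {set T}) (e : seq nat).

Definition upset_in D U : bool :=
  (U \subset D) && [forall x in U, forall y in D, le x y ==> (y \in U)].

(* The list is read from the last fibre to the first. *)
Fixpoint fib_count Q (re : seq nat) D : nat :=
  if re is c :: r then
    \sum_(U : {set T} | [&& upset_in D U, #|U| == c & Q U]) fib_count Q r (D :\: U)
  else D == set0.

(* Freezing [f] to [g] off [D] makes the removal of a fibre a change of [D] and
   [g] that leaves [f] itself unchanged. *)
Definition fibred Q D e k (g f : {ffun T -> 'I_k}) : bool :=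
  [&& [forall x, (x \notin D) ==> (f x == g x)],
      [forall x in D, f x < size e],
      [forall x in D, forall y in D, le x y ==> (f x <= f y)] &
      [forall i : 'I_k, (i < size e) ==>
         (#|[set x in D | f x == i]| == nth 0 e i) && Q [set x in D | f x == i]]].

Lemma fibredP Q D e k (g f : {ffun T -> 'I_k}) :
  reflect [/\ forall x, x \notin D -> f x = g x,
              forall x, x \in D -> f x < size e,
              forall x y, x \in D -> y \in D -> le x y -> f x <= f y &
              forall i : 'I_k, i < size e ->
                #|[set x in D | f x == i]| = nth 0 e i /\ Q [set x in D | f x == i]]
          (fibred Q D e g f).
Proof.
apply: (iffP and4P) => [[H1 H2 H3 H4]|[H1 H2 H3 H4]]; split.
- by move=> x xD; apply/eqP; move/forallP/(_ x)/implyP: H1; apply.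
- by move=> x xD; move/forall_inP: H2; apply.
- by move=> x y xD yD; move/forall_inP/(_ x xD)/forall_inP/(_ y yD)/implyP: H3.
- by move=> i lti; move/forallP/(_ i)/implyP/(_ lti)/andP: H4 => [/eqP].
- by apply/forallP=> x; apply/implyP=> /H1->.
- by apply/forall_inP.
- apply/forall_inP=> x xD; apply/forall_inP=> y yD; apply/implyP; exact: H3.
- by apply/forallP=> i; apply/implyP=> /H4[-> ->]; rewrite eqxx.
Qed.

Lemma card_fibred Q k (g : {ffun T -> 'I_k}) e D :
  size e <= k -> #|[set f | fibred Q D e g f]| = fib_count Q (rev e) D.
Proof.
elim/last_ind: e D g => [|e c IH] D g.
  move=> _ /=; case: (set_0Vmem D) => [->|[x xD]].
    rewrite eqxx /= -(cards1 g); apply: eq_card => f; rewrite !inE.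
    apply/fibredP/eqP => [[H _ _ _]|->].
      by apply/ffunP=> x; apply: H; rewrite inE.
    by split=> // x; rewrite inE.
  have -> : (D == set0) = false by apply/negP => /eqP D0; rewrite D0 inE in xD.
  by apply: eq_card0 => f; rewrite !inE; apply/fibredP => -[_ /(_ x xD)].
rewrite size_rcons rev_rcons => ltk; pose j := Ordinal ltk.
have nthe i : nth 0 (rcons e c) i = if i < size e then nth 0 e i else if i == size e then c else 0.
  by rewrite nth_rcons.
rewrite /= -sum1_card (partition_big (fun f : {ffun T -> 'I_k} => [set x in D | f x == j])
   (fun U => [&& upset_in D U, #|U| == c & Q U])) /=.
  apply: eq_bigr => U /and3P[/andP[UD /forall_inP upU] /eqP cU QU].
  pose gU := [ffun x => if x \in U then j else g x].
  rewrite -(IH _ gU); last exact: ltnW.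
  rewrite -sum1_card; apply: eq_bigl => f; rewrite !inE.
  have fibE (i : 'I_k) : i < size e ->
      (forall x, x \in U -> f x = j) ->
      [set x in D :\: U | f x == i] = [set x in D | f x == i].
    move=> lti fU; apply/setP=> x; rewrite !inE; case: (boolP (x \in U)) => //= /fU ->.
    by rewrite -val_eqE /= gtn_eqF // andbF.
  apply/andP/fibredP=> [[/fibredP[H1 H2 H3 H4] /eqP fU]|[H1 H2 H3 H4]].
    have fUj x : x \in U -> f x = j by rewrite -fU inE => /andP[_ /eqP].
    split.
    - move=> x; rewrite inE ffunE; case: (boolP (x \in U)) => [/fUj //|_ /=]; exact: H1.
    - move=> x; rewrite inE => /andP[xU xD].
      have := H2 x xD; rewrite size_rcons ltnS leq_eqVlt => /orP[/eqP fx|//].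
      by case/negP: xU; rewrite -fU inE xD -val_eqE /= fx eqxx.
    - move=> x y; rewrite !inE => /andP[_ xD] /andP[_ yD]; exact: H3.
    - move=> i lti; rewrite fibE //; have := H4 i.
      by rewrite size_rcons nthe lti; apply; apply: ltnW.
  have fUj x : x \in U -> f x = j by move=> xU; rewrite H1 ?ffunE ?inE ?xU.
  have fibU : [set x in D | f x == j] = U.
    apply/setP=> x; rewrite !inE; case: (boolP (x \in U)) => [xU|xU].
      by rewrite (subsetP UD) // fUj ?eqxx.
    apply/negP=> /andP[xD /eqP fx]; have := H2 x; rewrite inE xU xD fx ltnn.
    by move/(_ isT).
  split; last by rewrite fibU.
  apply/fibredP; split.
  - move=> x xD; rewrite H1 ?inE ?(negPf xD) ?andbF // ffunE.
    by case: ifP => // xU; rewrite (subsetP UD) in xD.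
  - move=> x xD; rewrite size_rcons ltnS; case: (boolP (x \in U)) => [/fUj -> //|xU].
    by apply/ltnW/H2; rewrite inE xU.
  - move=> x y xD yD lexy; case: (boolP (y \in U)) => [yU|yU].
      rewrite (fUj y) //; case: (boolP (x \in U)) => [/fUj -> //|xU].
      by apply/ltnW/H2; rewrite inE xU.
    case: (boolP (x \in U)) => [xU|xU]; last by apply: H3; rewrite ?inE ?xU ?yU.
    by case/negP: yU; move/implyP: (forall_inP (upU x xU) y yD); apply.
  - move=> i; rewrite size_rcons ltnS leq_eqVlt nthe => /orP[/eqP ei|lti].
      by rewrite ei ltnn eqxx (_ : i = j) ?fibU //; apply: val_inj.
    by rewrite lti -fibE //; apply: H4.
move=> f; rewrite inE => /fibredP[H1 H2 H3 H4].
have ltj : j < size (rcons e c) by rewrite size_rcons.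
have [-> ->] := H4 j ltj.
rewrite nthe ltnn !eqxx /= andbT.
apply/andP; split; first by apply/subsetP=> x; rewrite inE => /andP[].
apply/forall_inP=> x; rewrite inE => /andP[xD /eqP fx].
apply/forall_inP=> y yD; apply/implyP=> lexy; rewrite inE yD -val_eqE eqn_leq.
have := H3 x y xD yD lexy; rewrite fx => ->; rewrite andbT.
by have := H2 y yD; rewrite size_rcons ltnS.
Qed.

Lemma card_fibred_setT Q e :
  #|[set f : {ffun T -> 'I_(size e)} |
      [forall x, forall y, le x y ==> (f x <= f y)] &
      [forall i : 'I_(size e), (#|[set x | f x == i]| == nth 0 e i) && Q [set x | f x == i]]]|
  = fib_count Q (rev e) setT.
Proof.
have setTI' (f : {ffun T -> 'I_(size e)}) i : [set x in [set: T] | f x == i] = [set x | f x == i].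
  by apply/setP=> x; rewrite !inE.
have [g _|noG] := pickP {ffun T -> 'I_(size e)}.
  rewrite -(card_fibred Q g setT (leqnn _)); apply: eq_card => f; rewrite !inE.
  apply/andP/fibredP=> [[/forallP H1 /forallP H2]|[H1 H2 H3 H4]].
    split=> // [x|x y _ _|i _]; first by rewrite inE.
      by move/implyP: (forallP (H1 x) y).
    by rewrite setTI'; move/andP: (H2 i) => [/eqP].
  split; first by apply/forallP=> x; apply/forallP=> y; apply/implyP; apply: H3.
  by apply/forallP=> i; have := H4 i (ltn_ord i); rewrite setTI' => -[-> ->]; rewrite eqxx.
(* If there is no map to freeze to, [e] is empty and [T] is not, and both counts are zero. *)
rewrite eq_card0; last by move=> f; have := noG f.
case: e setTI' noG => [|c e] _ noG /=; last by have := noG [ffun=> ord0].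
case: (set_0Vmem [set: T]) => [T0|[x _]].
  have f0 (x : T) : 'I_0 by have := in_setT x; rewrite T0 inE.
  by have := noG [ffun x => f0 x].
by apply/esym/eqP; rewrite eqb0; apply/eqP=> T0; have := in_setT x; rewrite T0 inE.
Qed.

End FibreCount.

(** * Principal filters and the two recursions on the last fibre *)

Section PrincipalFilters.
Variables (T : finType) (le : rel T).
Hypotheses (le_refl : reflexive le) (le_anti : antisymmetric le) (le_trans : transitive le).
Implicit Types (D U A : {set T}).

Definition pfilter D x : {set T} := [set y in D | le x y].

(** Take an element of [A] below [y] with the fewest elements of [T] below it; an element of [A]
    strictly below that one would have fewer still. *)
Lemma exists_minimal_below A y : y \in A ->
  exists2 x, x \in A & le x y /\ forall z, z \in A -> le z x -> z = x.
Proof.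
move=> yA; have Py : (y \in A) && le y y by rewrite yA le_refl.
case: (@arg_minnP T y (fun x => (x \in A) && le x y) (fun x => #|[set z | le z x]|) Py).
move=> x /andP[xA lexy] xmin; exists x => //; split=> // z zA lezx.
have := xmin z; rewrite zA (le_trans lezx lexy) => /(_ isT) cardle.
apply: le_anti; rewrite lezx /=.
have /eqP E : [set t | le t z] == [set t | le t x].
  rewrite eqEcard cardle andbT; apply/subsetP=> t; rewrite !inE => letz.
  exact: le_trans letz lezx.
have : x \in [set t | le t x] by rewrite inE le_refl.
by rewrite -E inE.
Qed.

(** By finiteness every element of [A] lies above a minimal one, so a sole minimal element is a
    least element. *)
Lemma unique_minP A :
  reflect (exists2 x, x \in A & forall y, y \in A -> le x y) (unique_min le A).
Proof.
apply: (iffP cards1P) => [[x Ax]|[x xA xmin]].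
  have : x \in [set x] by rewrite inE.
  rewrite -Ax inE => /andP[xA _]; exists x => // y yA.
  have [z zA [lezy zmin]] := exists_minimal_below yA.
  suff -> : x = z by [].
  have : z \in [set x]; last by rewrite inE => /eqP.
  rewrite -Ax inE zA; apply/forall_inP=> t tA; apply/implyP=> letz.
  by apply/eqP/zmin.
exists x; apply/setP=> z; rewrite !inE; apply/andP/eqP=> [[zA zmin]|->].
  by apply/esym/eqP; move/implyP: (forall_inP zmin x xA); apply; apply: xmin.
split=> //; apply/forall_inP=> y yA; apply/implyP=> leyx; apply/eqP/le_anti.
by rewrite leyx xmin.
Qed.

Lemma pfilter_self D x : x \in D -> x \in pfilter D x.
Proof. by move=> xD; rewrite inE xD le_refl. Qed.

Lemma upset_pfilter D x : upset_in le D (pfilter D x).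
Proof.
apply/andP; split; first by apply/subsetP=> y; rewrite inE => /andP[].
apply/forall_inP=> y; rewrite inE => /andP[_ lexy].
apply/forall_inP=> z zD; apply/implyP=> leyz.
by rewrite inE zD (le_trans lexy leyz).
Qed.

Lemma upset_inP D U :
  reflect (U \subset D /\ forall x y, x \in U -> y \in D -> le x y -> y \in U)
          (upset_in le D U).
Proof.
apply: (iffP andP) => [[UD /forall_inP H]|[UD H]]; split=> //.
  by move=> x y xU yD; move/implyP: (forall_inP (H x xU) y yD).
by apply/forall_inP=> x xU; apply/forall_inP=> y yD; apply/implyP; apply: H.
Qed.

(** An upper set with a least element is the filter of that element; this turns the sum over last
    fibres in the starred count into a sum over elements. *)
Lemma upset_unique_min D U :
  (upset_in le D U && unique_min le U) = (U \in pfilter D @: D).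
Proof.
apply/andP/imsetP=> [[/upset_inP[UD upU] /unique_minP[x xU xmin]]|[x xD ->]].
  exists x; first exact: (subsetP UD).
  apply/setP=> y; rewrite inE; apply/idP/andP=> [yU|[yD lexy]].
    by rewrite (subsetP UD) // xmin.
  exact: upU lexy.
split; first exact: upset_pfilter.
by apply/unique_minP; exists x; [exact: pfilter_self|move=> y; rewrite inE => /andP[]].
Qed.

Lemma pfilter_inj D : {in D &, injective (pfilter D)}.
Proof.
move=> x y xD yD Exy; apply: le_anti; apply/andP; split.
  by have := pfilter_self yD; rewrite -Exy inE => /andP[].
by have := pfilter_self xD; rewrite Exy inE => /andP[].
Qed.

Lemma fib_count_unique_min_cons v r D :
  fib_count le (unique_min le) (v :: r) D =
  \sum_(x in D | #|pfilter D x| == v) fib_count le (unique_min le) r (D :\: pfilter D x).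
Proof.
rewrite /=; under eq_bigl => U do rewrite andbCA upset_unique_min andbC.
rewrite big_mkcondr big_imset /=; last exact: pfilter_inj.
by rewrite -big_mkcondr.
Qed.

(** This is the side condition for reindexing the upper sets of [D] that contain [x] by what they
    have outside the filter of [x]. The third conjunct amounts to [U] being disjoint from that
    filter. *)
Lemma upset_in_setU_pfilter D x U : x \in D ->
  [&& upset_in le D (pfilter D x :|: U), x \in pfilter D x :|: U
    & (pfilter D x :|: U) :\: pfilter D x == U] = upset_in le (D :\: pfilter D x) U.
Proof.
set V := pfilter D x => xD.
have VU : ((V :|: U) :\: V == U) = [disjoint U & V].
  by rewrite setDUl setDv set0U; apply/eqP/setDidPl.
rewrite VU inE pfilter_self //=.
apply/andP/upset_inP=> [[/upset_inP[VUD up] dUV]|[]].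
  split; first by rewrite subsetD dUV andbT; apply: subset_trans VUD; apply: subsetUr.
  move=> y z yU; rewrite inE => /andP[zV zD] leyz.
  have := up y z; rewrite !inE yU orbT => /(_ isT zD leyz).
  by rewrite -[(z \in D) && le x z](in_set (fun z => (z \in D) && le x z)) (negPf zV).
rewrite subsetD => /andP[UD dUV] up; split=> //; apply/upset_inP; split.
  by rewrite subUset UD andbT; case/andP: (upset_pfilter D x).
move=> y z; rewrite !in_setU => /orP[yV|yU] zD leyz.
  by have /upset_inP[_ /(_ y z yV zD leyz) ->] := upset_pfilter D x.
case: (boolP (z \in V)) => //= zV; apply: up yU _ leyz; by rewrite inE zV.
Qed.

(* Double counting of the pairs of a map and an element of its last fibre. *)
Lemma mul_fib_count_predT_cons c r D :
  c * fib_count le predT (c :: r) D =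
  \sum_(x in D | #|pfilter D x| <= c)
     fib_count le predT (c - #|pfilter D x| :: r) (D :\: pfilter D x).
Proof.
rewrite /= big_distrr /=.
transitivity (\sum_(U : {set T} | [&& upset_in le D U, #|U| == c & true])
                \sum_(x in U) fib_count le predT r (D :\: U)).
  by apply: eq_bigr => U /and3P[_ /eqP <- _]; rewrite sum_nat_const.
rewrite (exchange_big_dep (mem D)) /=; last first.
  by move=> U x /andP[/upset_inP[UD _] _] /(subsetP UD).
rewrite [RHS]big_mkcondr; apply: eq_bigr => x xD; set V := pfilter D x.
have subV U : upset_in le D U -> x \in U -> V \subset U.
  move=> /upset_inP[_ up] xU; apply/subsetP=> y; rewrite inE => /andP[yD lexy].
  exact: up lexy.
case: leqP => [leVc|ltcV]; last first.
  rewrite big_pred0 // => U; apply/negP=> /andP[/and3P[upU /eqP cU _] xU].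
  by move: ltcV; rewrite -cU ltnNge subset_leq_card ?subV.
(* An upper set of [D] containing [x] contains [V], so it is recovered from its part outside [V]. *)
rewrite (reindex_onto (fun U => V :|: U) (fun U => U :\: V)) /=; last first.
  by move=> U /andP[/and3P[upU _ _] xU]; rewrite setDE setUIr setUCr setIT (setUidPr (subV _ upU xU)).
apply: eq_big => [U|U _]; last by rewrite setDDl.
rewrite -(upset_in_setU_pfilter U xD) -/V !andbT.
case: (boolP (_ :\: V == U)) => [E|]; last by rewrite !andbF.
have -> : (#|V :|: U| == c) = (#|U| == c - #|V|).
  rewrite -{2}(eqP E) -(cardsID V (V :|: U)) (setIidPr (subsetUl V U)).
  by apply/eqP/eqP; lia.
by rewrite !andbT andbAC.
Qed.

(** Only the empty set has size 0. This absorbs the zero exponents, including the one left when a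
    filter fills the whole last fibre. *)
Lemma fib_count_predT_0cons r D : fib_count le predT (0 :: r) D = fib_count le predT r D.
Proof.
rewrite /= (big_pred1 set0) ?setD0 // => U.
rewrite cards_eq0 andbT andbC [RHS]/=; case: eqP => //= ->.
by apply/upset_inP; split=> [|x y]; rewrite ?sub0set ?inE.
Qed.

End PrincipalFilters.

(** * Partial sums and blocks of a composition *)

Section PartialSums.
Implicit Types a : seq nat.

Lemma psumS a i : psum a i.+1 = psum a i + nth 0 a i.
Proof.
rewrite /psum; case: (ltnP i (size a)) => [lti|lei].
  by rewrite (take_nth 0 lti) sumn_rcons.
by rewrite nth_default // !take_oversize ?addn0 // ltnW.
Qed.

Lemma leq_psum a : {homo psum a : i j / i <= j}.
Proof. by apply: homo_leq leq_trans _ => // i; rewrite psumS leq_addr. Qed.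

Lemma psum_size a : psum a (size a) = sumn a.
Proof. by rewrite /psum take_size. Qed.

Lemma psum_rcons a v i : i <= size a -> psum (rcons a v) i = psum a i.
Proof. by move=> lei; rewrite /psum -cats1 takel_cat. Qed.

Lemma leq_psum_sumn a i : psum a i <= sumn a.
Proof. by rewrite -[X in _ <= sumn X](cat_take_drop i a) sumn_cat leq_addr. Qed.

Lemma in_block_inj a i i' j : in_block a i j -> in_block a i' j -> i = i'.
Proof.
move=> /andP[lo hi] /andP[lo' hi']; apply/eqP; rewrite eqn_leq; apply/andP; split.
  by rewrite leqNgt; apply/negP=> /(@leq_psum a); lia.
by rewrite leqNgt; apply/negP=> /(@leq_psum a); lia.
Qed.

(** The block is the one ending at the first partial sum beyond [j]. A sigma type is used because
    [blk] extracts the index as data. *)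
Lemma in_block_ex a j : j < sumn a -> {i : 'I_(size a) | in_block a i j}.
Proof.
rewrite -psum_size => ltj; pose P i := j < psum a i.
have exP : exists i, P i by exists (size a).
case: (ex_minnP exP) => -[|i]; first by rewrite /P /psum take0.
move=> ltji imin; have lti : i < size a by apply: imin.
exists (Ordinal lti); rewrite /in_block /= andbC (ltji : j < _) leqNgt.
by apply/negP=> /imin; rewrite ltnn.
Qed.

Lemma psum_nth_gt0 a i : all (fun k => 0 < k) a -> i < size a -> psum a i < psum a i.+1.
Proof. by move=> /all_nthP a0 lti; rewrite psumS -addn1 leq_add2l a0. Qed.

End PartialSums.

Lemma card_ord_lt n k : k <= n -> #|[set j : 'I_n | j < k]| = k.
Proof.
move=> lekn; rewrite -sum1_card -[RHS](card_ord k) -sum1_card (big_ord_widen n (fun=> 1)) //.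
by apply: eq_bigl => j; rewrite inE.
Qed.

(** * Starred linear extensions as order-preserving maps onto the blocks *)

Section LinearExtensions.
Variables (n : nat) (T : finType) (le : rel T) (w : T -> 'I_n).
Hypotheses (le_refl : reflexive le) (le_anti : antisymmetric le) (le_trans : transitive le).
Hypotheses (w_bij : bijective w).
Hypothesis w_nat : forall x y : T, le x y -> x != y -> w x < w y.
Variable a : seq nat.
Hypothesis comp_a : is_comp n a.

Implicit Types (s : 'S_n) (f : {ffun T -> 'I_(size a)}).

Let w_inj : injective w := bij_inj w_bij.

Definition pos (s : 'S_n) (x : T) : 'I_n := (s^-1)%g (w x).

Lemma pos_inj s : injective (pos s).
Proof. by move=> x y /perm_inj /w_inj. Qed.

Lemma perm_pos s x : s (pos s x) = w x. Proof. exact: permKV. Qed.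

Lemma comp_sumn : sumn a = n. Proof. by case/andP: comp_a => _ /eqP. Qed.

Lemma ord_lt_sumn (j : 'I_n) : j < sumn a. Proof. by rewrite comp_sumn. Qed.

Definition blk (j : 'I_n) : 'I_(size a) := sval (in_block_ex (ord_lt_sumn j)).

Lemma in_blockE (j : 'I_n) (i : 'I_(size a)) : in_block a i j = (blk j == i).
Proof.
rewrite /blk; case: in_block_ex => i' /= i'j.
apply/idP/eqP => [ij|<- //]; apply: val_inj; exact: in_block_inj i'j ij.
Qed.

Lemma leq_blk (j j' : 'I_n) : j <= j' -> blk j <= blk j'.
Proof.
move=> lejj'; rewrite leqNgt; apply/negP=> /(@leq_psum a).
have /andP[lo hi] : in_block a (blk j) j by rewrite in_blockE.
have /andP[lo' hi'] : in_block a (blk j') j' by rewrite in_blockE.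
by lia.
Qed.

Definition blockmap (s : 'S_n) : {ffun T -> 'I_(size a)} := [ffun x => blk (pos s x)].

Lemma fibre_blockmap s (i : 'I_(size a)) : [set x | blockmap s x == i] = blockP w a s i.
Proof.
apply/setP=> x; rewrite !inE ffunE -in_blockE; apply/idP/existsP => [ij|[j /andP[ij /eqP sj]]].
  by exists (pos s x); rewrite ij perm_pos eqxx.
by rewrite /pos -sj permK.
Qed.

Lemma w_surj j : exists x, w x = j.
Proof. by case: w_bij => v _ vK; exists (v j). Qed.

Lemma pos_surj s j : exists x, pos s x = j.
Proof. by have [x wx] := w_surj (s j); exists x; rewrite /pos wx permK. Qed.

Lemma card_preim_pos s (A : {set 'I_n}) : #|[set x | pos s x \in A]| = #|A|.
Proof.
rewrite -(card_imset _ (@pos_inj s)); apply: eq_card => j.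
apply/imsetP/idP => [[x + ->]|jA]; first by rewrite inE.
by have [x xj] := pos_surj s j; exists x; rewrite ?inE xj.
Qed.

Lemma card_pos_lt s k : k <= n -> #|[set x | pos s x < k]| = k.
Proof.
move=> lek; rewrite -[RHS](card_ord_lt lek) -(card_preim_pos s).
by apply: eq_card => x; rewrite !inE.
Qed.

(** A block is the difference of two initial segments of positions, whose sizes are known. *)
Lemma card_fibre_blockmap s (i : 'I_(size a)) : #|[set x | blockmap s x == i]| = nth 0 a i.
Proof.
have le1 : psum a i.+1 <= n by rewrite -comp_sumn leq_psum_sumn.
have le0 : psum a i <= n by rewrite -comp_sumn leq_psum_sumn.
apply: (@addnI (psum a i)); rewrite -psumS -[RHS](card_pos_lt s le1).
rewrite -[X in X + _](card_pos_lt s le0) -(cardsID [set x | pos s x < psum a i] [set x | pos s x < psum a i.+1]).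
congr (_ + _); apply: eq_card => x; rewrite !inE.
  apply/idP/andP=> [lt0|[] //]; split=> //; apply: leq_trans lt0 _; exact: leq_psum.
by rewrite ffunE -in_blockE /in_block -leqNgt.
Qed.

Lemma nth_word s (j : 'I_n) : nth 0 (word s) j = s j.
Proof. by rewrite (nth_map j) ?size_enum_ord // nth_ord_enum. Qed.

Lemma lin_extP s :
  reflect (forall x y, le x y -> x != y -> pos s x < pos s y) (lin_ext le w s).
Proof.
apply: (iffP forallP) => [H x y lexy nxy|H x].
  by move/implyP: (forallP (H x) y); rewrite lexy nxy; apply.
by apply/forallP=> y; apply/implyP=> /andP[]; apply: H.
Qed.

Lemma unimodal_unique_min_increasing s (i : 'I_(size a)) :
  lin_ext le w s -> unimodal_on (word s) (psum a i) (psum a i.+1) ->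
  unique_min le (blockP w a s i) ->
  forall x y, blockmap s x = i -> blockmap s y = i -> pos s x < pos s y -> w x < w y.
Proof.
move=> /lin_extP ext /existsP[k /andP[lok /forallP uni]].
move=> /(unique_minP le_refl le_anti le_trans)[z].
rewrite -fibre_blockmap inE => /eqP zi zmin x y xi yi ltxy.
set lo := psum a i in lok uni *; set hi := psum a i.+1 in k lok uni *.
have lehi : hi <= n by rewrite -comp_sumn leq_psum_sumn.
have posB t : (blockmap s t == i) = (lo <= pos s t < hi) by rewrite ffunE -in_blockE.
have wordE t : nth 0 (word s) (pos s t) = w t by rewrite nth_word perm_pos.
have posK j : lo <= j < hi -> exists2 t, pos s t = j :> nat & le z t.
  move=> /andP[loj jhi]; have [t tj] := pos_surj s (Ordinal (leq_trans jhi lehi)).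
  by exists t; [rewrite tj|apply: zmin; rewrite inE posB tj /= loj].
have lohi : lo < hi by move/eqP: xi; rewrite posB => /andP[/leq_ltn_trans]; apply.
(* The element listed at [lo] lies above [z], so the linear extension lists [z] no later; being in
   the block, [z] is itself at [lo]. *)
have zlo : pos s z = lo :> nat.
  have [|t tlo lezt] := posK lo; first by rewrite leqnn.
  case: (eqVneq z t) => [->//|nzt]; have := ext z t lezt nzt; rewrite tlo.
  by move/eqP: zi; rewrite posB; lia.
(* A valley after [lo] would make the first step a descent from the label of [z], but [z] lies below
   the next element and so has the smaller label. *)
have klo : k = lo :> nat.
  apply/eqP; rewrite eqn_leq lok andbT leqNgt; apply/negP=> ltlok.
  have lo1 : lo.+1 < hi by apply: leq_ltn_trans (ltn_ord k).
  have := uni (Ordinal lohi); rewrite /= leqnn lo1 ltlok /= => /andP[].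
  have [|t tlo lezt] := posK lo.+1; first by rewrite leqnSn lo1.
  rewrite -tlo -zlo !wordE ltnNge => /negP[]; apply/ltnW/w_nat => //.
  by apply/eqP => zt; move: tlo; rewrite -zt zlo; lia.
have incr j j' : lo <= j -> j < j' -> j' < hi -> nth 0 (word s) j < nth 0 (word s) j'.
  move=> loj; elim: j' => // j' IH; rewrite ltnS => lejj' lt'.
  have step : nth 0 (word s) j' < nth 0 (word s) j'.+1.
    have := uni (Ordinal (ltnW lt')) => /=; rewrite klo (leq_trans loj lejj') lt' /=.
    by move=> /andP[].
  move: lejj'; rewrite leq_eqVlt => /orP[/eqP->//|ltjj'].
  exact: ltn_trans (IH ltjj' (ltnW lt')) step.
rewrite -!wordE; apply: incr => //.
  by move/eqP: xi; rewrite posB => /andP[].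
by move/eqP: yi; rewrite posB => /andP[].
Qed.

Definition lexlt (f : {ffun T -> 'I_(size a)}) : rel T :=
  fun x y => (f x < f y) || (f x == f y) && (w x < w y).

(* The position of [x] in the starred linear extension attached to [f]. *)
Definition lexrank f x : nat := #|[set y | lexlt f y x]|.

Lemma lexlt_trans f : transitive (lexlt f).
Proof. by move=> y x z; rewrite /lexlt -!val_eqE /=; lia. Qed.

Lemma lexlt_irr f x : lexlt f x x = false.
Proof. by rewrite /lexlt -!val_eqE /=; lia. Qed.

Lemma lexlt_total f x y : x != y -> lexlt f x y || lexlt f y x.
Proof. by rewrite -(inj_eq w_inj) /lexlt -!val_eqE /=; lia. Qed.

(** Initial segments of a strict total order are strictly nested, so counting predecessors embeds
    the order. *)
Lemma ltn_lexrank f x y : (lexrank f x < lexrank f y) = lexlt f x y.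
Proof.
have imp t u : lexlt f t u -> lexrank f t < lexrank f u.
  move=> lt; apply/proper_card/properP; split.
    by apply/subsetP=> v; rewrite !inE => /lexlt_trans; apply.
  by exists t; rewrite !inE ?lexlt_irr.
apply/idP/idP => [ltr|]; last exact: imp.
case: (eqVneq x y) => [E|/(lexlt_total f)/orP[//|/imp]]; first by rewrite E ltnn in ltr.
by move: ltr; lia.
Qed.

Definition starred (s : 'S_n) : bool :=
  [&& lin_ext le w s, alpha_unimodal a s &
      [forall i : 'I_(size a), unique_min le (blockP w a s i)]].

Definition star_map (f : {ffun T -> 'I_(size a)}) : bool :=
  [forall x, forall y, le x y ==> (f x <= f y)] &&
  [forall i : 'I_(size a), (#|[set x | f x == i]| == nth 0 a i) &&
     unique_min le [set x | f x == i]].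

(** Positions follow the order of the blocks, and inside a block the labels increase with the
    position. The converse follows by comparing the two positions. *)
Lemma starred_ltn_pos s x y : starred s -> (pos s x < pos s y) = lexlt (blockmap s) x y.
Proof.
move=> /and3P[ext uni /forallP um].
have incr t u : blockmap s t = blockmap s u -> pos s t < pos s u -> w t < w u.
  move=> E; apply: (@unimodal_unique_min_increasing s (blockmap s u)) => //.
  by move/allP: uni; apply; rewrite mem_iota /=.
have imp t u : pos s t < pos s u -> lexlt (blockmap s) t u.
  move=> lt; rewrite /lexlt; have : blockmap s t <= blockmap s u.
    by rewrite !ffunE; apply/leq_blk/ltnW.
  rewrite leq_eqVlt => /orP[/eqP/val_inj E|-> //].
  by rewrite E eqxx (incr _ _ E lt) orbT.
apply/idP/idP => [|lt]; first exact: imp.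
case: (ltngtP (pos s x) (pos s y)) => // [/imp lt'|/val_inj/pos_inj E].
  by have := lexlt_trans lt lt'; rewrite lexlt_irr.
by rewrite E lexlt_irr in lt.
Qed.

(** Counting predecessors recovers the positions from the block map alone, which is why [blockmap]
    is injective on starred extensions. *)
Lemma starred_pos s x : starred s -> pos s x = lexrank (blockmap s) x :> nat.
Proof.
move=> ss; rewrite -[LHS](card_pos_lt s (ltnW (ltn_ord _))).
by apply: eq_card => y; rewrite !inE starred_ltn_pos.
Qed.

Lemma starred_star_map s : starred s -> star_map (blockmap s).
Proof.
move=> /and3P[/lin_extP ext uni /forallP um]; apply/andP; split.
  apply/forallP=> x; apply/forallP=> y; apply/implyP=> lexy; rewrite !ffunE.
  case: (eqVneq x y) => [->//|nxy]; apply/leq_blk/ltnW; exact: ext.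
apply/forallP=> i; rewrite card_fibre_blockmap eqxx fibre_blockmap; exact: um.
Qed.

Lemma blockmap_inj : {in starred &, injective blockmap}.
Proof.
move=> s s' ss ss' E; apply: invg_inj; apply/permP=> j.
have [x <-] := w_surj j; apply: val_inj.
by rewrite [LHS]starred_pos // [RHS]starred_pos // E.
Qed.

Lemma card_star_map_lt f k : star_map f -> k <= size a -> #|[set x | f x < k]| = psum a k.
Proof.
move=> /andP[_ /forallP sz]; elim: k => [|k IH] ltk.
  by rewrite /psum take0; apply: eq_card0 => x; rewrite inE.
rewrite psumS -IH; last exact: ltnW.
have /andP[/eqP <- _] := sz (Ordinal ltk).
rewrite -(cardsID [set x | f x < k] [set x | f x < k.+1]).
by congr (_ + _); apply: eq_card => x; rewrite !inE -?val_eqE /=; lia.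
Qed.

(** The preimage lists [T] in the order [lexlt f]: the position of [x] is its rank. *)
Lemma star_map_blockmap f : star_map f -> exists2 s, starred s & blockmap s = f.
Proof.
move=> sf; have /andP[/forallP mon /forallP sz] := sf.
(* All elements of lower fibres precede [x], and all that precedes [x] lies in fibres up to its own,
   with [x] itself left out; the fibre sizes turn this into the bounds of the block. *)
have inB x : in_block a (f x) (lexrank f x).
  have ltf : f x < size a by [].
  apply/andP; split.
    rewrite -(card_star_map_lt sf (ltnW ltf)); apply/subset_leq_card/subsetP=> y.
    by rewrite !inE /lexlt => ->.
  rewrite -(card_star_map_lt sf ltf); apply/proper_card/properP; split.
    by apply/subsetP=> y; rewrite !inE /lexlt -val_eqE /=; lia.
  by exists x; rewrite !inE ?lexlt_irr.
have ltn_rk x : lexrank f x < n.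
  by rewrite -comp_sumn; case/andP: (inB x) => _ /leq_trans; apply; apply: leq_psum_sumn.
pose rk x := Ordinal (ltn_rk x).
have rk_inj : injective rk.
  move=> x y [E]; apply/eqP/negPn/negP=> /(lexlt_total f).
  by rewrite -!ltn_lexrank E ltnn.
have [v wK vK] := w_bij.
have p_inj : injective (rk \o v) := inj_comp rk_inj (can_inj vK).
(* The permutation of [p_inj] sends labels to ranks, whereas [s] sends positions to labels. *)
pose s := ((perm p_inj)^-1)%g.
have posE x : pos s x = rk x by rewrite /pos /s invgK permE /= wK.
have fE : blockmap s = f.
  by apply/ffunP=> x; apply/eqP; rewrite ffunE -in_blockE posE; apply: inB.
exists s => //; apply/and3P; split.
- apply/lin_extP=> x y lexy nxy; rewrite !posE /= ltn_lexrank /lexlt -val_eqE /=.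
  rewrite w_nat // andbT orbC -leq_eqVlt.
  by have /implyP := forallP (mon x) y; apply.
- apply/allP=> i; rewrite mem_iota /= add0n => lti.
  have [a0 _] := andP comp_a.
  have lohi := psum_nth_gt0 a0 lti.
  (* The valley is the first position of the block, which leaves only the ascending condition. *)
  apply/existsP; exists (Ordinal lohi); rewrite /= leqnn /=.
  apply/forallP=> j; apply/implyP=> /andP[loj ltj].
  have lehi : psum a i.+1 <= n by rewrite -comp_sumn leq_psum_sumn.
  have -> : (j < psum a i) = false by lia.
  rewrite loj /=; have ltj1 := leq_trans ltj lehi.
  have [x xj] := pos_surj s (Ordinal (ltnW ltj1)).
  have [y yj] := pos_surj s (Ordinal ltj1).
  have -> : j = pos s x :> nat by rewrite xj.
  rewrite (_ : (pos s x).+1 = pos s y) ?nth_word ?perm_pos; last by rewrite xj yj.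
  have : lexlt f x y by rewrite -ltn_lexrank -[lexrank f x]/(val (rk x))
    -[lexrank f y]/(val (rk y)) -!posE xj yj /=.
  (* Two positions in one block have equal values of [f], so [lexlt] compares labels here. *)
  rewrite /lexlt -fE => /orP[|/andP[] //]; rewrite !ffunE.
  have xB : in_block a (Ordinal lti) (pos s x) by rewrite xj /in_block /= loj; lia.
  have yB : in_block a (Ordinal lti) (pos s y) by rewrite yj /in_block /= ltj; lia.
  by move: xB yB; rewrite !in_blockE => /eqP-> /eqP->; rewrite ltnn.
- by apply/forallP=> i; rewrite -fibre_blockmap fE; case/andP: (sz i).
Qed.

(** [blockmap] is a bijection from the starred extensions to the star maps, which [card_fibred_setT]
    counts. *)
Lemma Lstar_fib_count : Lstar le w a = fib_count le (unique_min le) (rev a) setT.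
Proof.
rewrite -card_fibred_setT /Lstar -(card_in_imset (f := blockmap)); last first.
  by move=> s s'; rewrite !inE; apply: blockmap_inj.
apply: eq_card => f; rewrite [RHS]inE; apply/imsetP/idP => [[s + ->]|].
  by rewrite inE => /starred_star_map.
by move=> /star_map_blockmap[s ss <-]; exists s; rewrite ?inE.
Qed.

End LinearExtensions.

Lemma coefKP_fib_count (T : finType) (le : rel T) e :
  coefKP le e = fib_count le predT (rev e) setT.
Proof.
rewrite -card_fibred_setT; apply: eq_card => f; rewrite !inE; congr (_ && _).
by apply: eq_forallb => i; rewrite andbT.
Qed.

(** * Sums over sequences of bounded length and entries *)

Section SumSeqs.
Local Open Scope ring_scope.
Variable N : nat.
Implicit Types F : seq nat -> rat.

(** Sequences of length at most [K] grow by appending, so [v] is the last part and one unfolding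
    splits off the last block. The bound [N] on the entries stays fixed while [K] drops. *)
Fixpoint sum_seqs K F : rat :=
  F [::] + (if K is K'.+1 then \sum_(v < N) sum_seqs K' (fun a => F (rcons a v)) else 0).

Lemma eq_sum_seqs K F G : F =1 G -> sum_seqs K F = sum_seqs K G.
Proof.
elim: K F G => [|K IH] F G FG /=; rewrite FG //; congr (_ + _).
by apply: eq_bigr => v _; apply: IH => a.
Qed.

Lemma sum_seqsE K F :
  sum_seqs K F = \sum_(k < K.+1) \sum_(t : k.-tuple 'I_N) F [seq val i | i <- t].
Proof.
elim: K F => [|K IH] F.
  rewrite big_ord_recl big_ord0 /=; congr (_ + _).
  by rewrite (big_pred1 [tuple]) // => t; apply/esym/eqP/tuple0.
rewrite big_ord_recl /=; congr (_ + _).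
  by rewrite (big_pred1 [tuple]) // => t; apply/esym/eqP/tuple0.
under eq_bigr => v _ do rewrite IH.
rewrite exchange_big /=; apply: eq_bigr => k _.
rewrite pair_big /= (reindex (fun p : 'I_N * k.-tuple 'I_N => [tuple of rcons p.2 p.1])) /=.
  by apply: eq_bigr => -[v t] _; rewrite map_rcons.
exists (fun t : k.+1.-tuple 'I_N => (tnth t ord_max, [tuple of belast (thead t) (behead t)])).
  move=> [v t] _; congr (_, _).
    by rewrite (tnth_nth v) /= nth_rcons size_tuple ltnn eqxx.
  apply: val_inj => /=; case: t => -[|x t] //= tP.
  by rewrite /thead (tnth_nth v) /= belast_rcons.
move=> t _; apply: val_inj; case/tupleP: t => x t /=.
by rewrite (tnth_nth x) /= theadE [RHS]lastI (last_nth x) size_tuple.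
Qed.

Lemma sum_comps_seqs n F : N = n.+1 ->
  sum_comps n F = sum_seqs n (fun a => if is_comp n a then F a else 0).
Proof.
move=> NE; rewrite sum_seqsE NE; apply: eq_bigr => k _; exact: big_mkcond.
Qed.

Lemma sum_seqs_eq0 K F : (forall a, F a = 0) -> sum_seqs K F = 0.
Proof. by move=> F0; rewrite sum_seqsE big1 // => k _; rewrite big1. Qed.

Lemma sum_seqsZ K c F : sum_seqs K (fun a => c * F a) = c * sum_seqs K F.
Proof.
rewrite !sum_seqsE big_distrr; apply: eq_bigr => k _; by rewrite big_distrr.
Qed.

Lemma sum_seqs_sum K (I : finType) (P : pred I) (F : I -> seq nat -> rat) :
  sum_seqs K (fun a => \sum_(i | P i) F i a) = \sum_(i | P i) sum_seqs K (F i).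
Proof.
rewrite sum_seqsE; under eq_bigr => k _ do rewrite exchange_big.
by rewrite exchange_big; apply: eq_bigr => i _; rewrite sum_seqsE.
Qed.

End SumSeqs.

(** * Coefficients of [M_beta], refinement and the products [pi(alpha, beta)] *)

Lemma sum_comps_pred1 n b (F : seq nat -> rat) : is_comp n b ->
  (forall a, is_comp n a -> a != b -> F a = 0%R) -> sum_comps n F = F b.
Proof.
move=> compb F0; have [/allP b0 /eqP sumb] := andP compb.
(* Positive parts summing to [n] number at most [n], and each is at most [n], so [b] is among the
   indices of the sum. *)
have ltsz : size b < n.+1.
  rewrite ltnS -sumb; elim: {compb sumb F0} b b0 => //= x b IH b0.
  by rewrite -add1n leq_add ?b0 ?mem_head // IH // => y yb; rewrite b0 // inE yb orbT.
have ltn x : x \in b -> x < n.+1.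
  by move=> /rot_to[i r E]; rewrite ltnS -sumb -(sumn_rot b i) E leq_addr.
pose t0 : seq 'I_n.+1 := [seq inord x | x <- b].
have t0E : [seq val i | i <- t0] = b.
  by rewrite -map_comp -[RHS]map_id; apply/eq_in_map => x xb /=; rewrite inordK ?ltn.
have szt : size t0 == Ordinal ltsz by rewrite size_map.
rewrite /sum_comps (bigD1 (Ordinal ltsz)) //= [X in (_ + X)%R]big1 ?GRing.addr0; last first.
  move=> k nk; rewrite big1 // => t ct; apply: F0 => //.
  apply: contraNneq nk => E; apply/eqP/val_inj => /=.
  by rewrite -E size_map size_tuple.
rewrite (bigD1 (Tuple szt)) /= ?t0E //= big1 ?GRing.addr0 // => t /andP[ct nt].
apply: F0 => //; apply: contraNneq nt => E; apply/eqP/val_inj/(inj_map val_inj).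
by rewrite E /= t0E.
Qed.

(** As the parts of [b] are positive, a tuple counted here must list the positions of the nonzero
    exponents in increasing order. There is one such list, and it fits exactly when [b] is [e]
    without its zeros. *)
Lemma coefMonE b e : all (fun k => 0 < k) b ->
  coefMon b e = (b == [seq x <- e | 0 < x]).
Proof.
move=> b0; pose s0 := [seq j : 'I_(size e) <- enum 'I_(size e) | 0 < nth 0 e j].
have s0E : [seq nth 0 e j | j : 'I_(size e) <- s0] = [seq x <- e | 0 < x].
  rewrite -filter_map; congr filter.
  apply: (@eq_from_nth _ 0) => [|i]; rewrite size_map size_enum_ord // => lti.
  by rewrite (nth_map (Ordinal lti)) ?size_enum_ord // nth_enum_ord.
have mem_s0 j : (j \in s0) = (0 < nth 0 e j) by rewrite mem_filter mem_enum andbT.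
have lt_tr : transitive (fun x y : 'I_(size e) => x < y) by move=> y x z; apply: ltn_trans.
have srt0 : sorted (fun x y : 'I_(size e) => x < y) s0.
  apply: sorted_filter => //.
  by have := iota_ltn_sorted 0 (size e); rewrite -val_enum_ord sorted_map.
have tE (t : (size b).-tuple 'I_(size e)) :
   sorted (fun x y : nat => x < y) [seq val i | i <- t] ->
   (forall j : 'I_(size e), nth 0 e j = if j \in t then nth 0 b (index j t) else 0) ->
   tval t = s0.
  move=> srt H; apply: (irr_sorted_eq lt_tr) => //; first by move=> j; rewrite /= ltnn.
    by rewrite sorted_map in srt.
  move=> j; rewrite mem_s0 H; case: ifP => // jt.
  have : index j t < size t by rewrite index_mem.
  by rewrite size_tuple => /(all_nthP 0 b0).
rewrite /coefMon; case: eqP => [bE|nbE].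
  have szt : size s0 == size b by rewrite bE -s0E size_map.
  rewrite -[RHS](cards1 (Tuple szt)); apply: eq_card => t; rewrite !inE.
  apply/andP/eqP => [[srt /forallP H]|->].
    by apply/val_inj/tE => // j; apply/eqP.
  split; first by rewrite sorted_map.
  apply/forallP=> j; have -> : (j \in Tuple szt) = (j \in s0) by [].
  have -> i : nth 0 b i = nth 0 [seq nth 0 e j | j : 'I_(size e) <- s0] i by rewrite s0E -bE.
  case: ifP => js.
    by rewrite (nth_map j) ?index_mem // nth_index.
  by rewrite mem_s0 in js; rewrite eqn0Ngt js.
apply: eq_card0 => t; rewrite !inE; apply/negP => /andP[srt /forallP H].
have {}H (j : 'I_(size e)) : nth 0 e j = if j \in t then nth 0 b (index j t) else 0 by apply/eqP.
apply: nbE; rewrite -s0E -(tE _ srt H).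
apply: (@eq_from_nth _ 0) => [|i lti]; first by rewrite size_map size_tuple.
have lti' : i < size t by rewrite size_tuple.
rewrite (nth_map (tnth t (Ordinal lti))) // H mem_nth // index_uniq //.
rewrite (tE _ srt H) filter_uniq ?enum_uniq //.
Qed.

(* [restr a b i] is [parts_between a (psum b i) (psum b i.+1)]. *)
Definition parts_between (a : seq nat) lo hi : seq nat :=
  [seq nth 0 a j | j <- iota 0 (size a) & (lo <= psum a j) && (psum a j.+1 <= hi)].

Lemma parts_between_rcons a v lo hi :
  parts_between (rcons a v) lo hi = parts_between a lo hi ++
    (if (lo <= sumn a) && (sumn a + v <= hi) then [:: v] else [::]).
Proof.
rewrite /parts_between size_rcons -addn1 iotaD filter_cat map_cat /= add0n; congr (_ ++ _).
  have E : {in iota 0 (size a), (fun j => (lo <= psum (rcons a v) j) && (psum (rcons a v) j.+1 <= hi))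
      =1 (fun j => (lo <= psum a j) && (psum a j.+1 <= hi))}.
    by move=> j; rewrite mem_iota /= add0n => ltj; rewrite (psum_rcons _ (ltnW ltj)) (psum_rcons _ ltj).
  rewrite (eq_in_filter E); apply/eq_in_map => j; rewrite mem_filter mem_iota /= add0n => /andP[_ ltj].
  by rewrite nth_rcons ltj.
rewrite psum_rcons // psumS psum_rcons // psum_size nth_rcons ltnn eqxx.
by case: ifP => //=; rewrite nth_rcons ltnn eqxx.
Qed.

Lemma parts_between_sumn a lo hi : sumn a <= hi ->
  parts_between a lo hi = parts_between a lo (sumn a).
Proof.
move=> lehi; congr map; apply: eq_filter => j.
by rewrite leq_psum_sumn (leq_trans (leq_psum_sumn _ _) lehi).
Qed.

Lemma parts_between_sumn_nil a hi : all (fun k => 0 < k) a -> parts_between a (sumn a) hi = [::].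
Proof.
move=> a0; rewrite /parts_between (eq_in_filter (a2 := pred0)) ?filter_pred0 // => j.
rewrite mem_iota /= add0n => ltj; have := psum_nth_gt0 a0 ltj.
by have := leq_psum_sumn a j.+1; lia.
Qed.

(** The lower end is a partial sum of [a], so no part straddles it and the parts beyond it fill the
    rest of the total. *)
Lemma sumn_parts_between a j : all (fun k => 0 < k) a -> j <= size a ->
  sumn (parts_between a (psum a j) (sumn a)) + psum a j = sumn a.
Proof.
elim/last_ind: a => [|a v IH] => [_|]; first by rewrite leqn0 => /eqP->.
move=> a0; rewrite size_rcons leq_eqVlt => /orP[/eqP->|].
  by rewrite -(size_rcons a v) psum_size parts_between_sumn_nil.
rewrite ltnS => lej; move: a0; rewrite all_rcons => /andP[v0 a0].
rewrite psum_rcons // parts_between_rcons sumn_rcons leqnn leq_psum_sumn /=.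
by rewrite parts_between_sumn ?leq_addr // sumn_cat /= addn0 addnAC IH.
Qed.

Lemma pi_comp_rcons g v : pi_comp (rcons g v) = pi_comp g * (sumn g + v).
Proof.
rewrite /pi_comp size_rcons big_ord_recr /=; congr (_ * _).
  by apply: eq_bigr => i _; rewrite psum_rcons.
by rewrite -(size_rcons g v) psum_size sumn_rcons.
Qed.

Lemma pi_pair_rcons a b c : pi_pair a (rcons b c) =
  (\prod_(i < size b) pi_comp (restr a b i)) * pi_comp (parts_between a (sumn b) (sumn b + c)).
Proof.
rewrite /pi_pair size_rcons big_ord_recr /=; congr (_ * _).
  apply: eq_bigr => i _; congr pi_comp.
  rewrite -[LHS]/(parts_between _ _ _) !psum_rcons //; exact: ltnW.
rewrite -[restr _ _ _]/(parts_between _ _ _) psum_rcons // psum_size.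
by rewrite -(size_rcons b c) psum_size sumn_rcons.
Qed.

(** [Sset] leaves out 0 and the total, but these are partial sums of both sequences and may be
    included. Conversely an inner partial sum of [b] lies strictly between them, so its index in [a]
    is an inner one. *)
Lemma comp_leP a b : all (fun k => 0 < k) a -> all (fun k => 0 < k) b -> sumn a = sumn b ->
  reflect (forall i, i <= size b -> exists2 j, j <= size a & psum b i = psum a j) (comp_le a b).
Proof.
move=> a0 b0 ab; apply: (iffP allP) => [H i|H s /mapP[i]].
  rewrite leq_eqVlt => /orP[/eqP->|lti]; first by exists (size a); rewrite ?psum_size.
  case: (posnP i) => [->|i0]; first by exists 0; rewrite // /psum !take0.
  have /mapP[j] : psum b i \in Sset a by apply/H/map_f; rewrite mem_iota; lia.
  by rewrite mem_iota => lej ->; exists j => //; lia.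
rewrite mem_iota => lti sE; have [|j lej E] := H i; first by lia.
rewrite sE E; apply: map_f; rewrite mem_iota.
have : psum b 0 < psum b i.
  apply: leq_trans (psum_nth_gt0 b0 _) (leq_psum _ _); lia.
have : psum b i < psum b (size b).
  apply: leq_trans (psum_nth_gt0 b0 _) (leq_psum _ _); lia.
rewrite psum_size -ab /psum take0 -!/(psum _ _) E.
case: (posnP j) => [->|]; first by rewrite /psum take0.
by case: (eqVneq j (size a)) => [->|]; rewrite ?psum_size; lia.
Qed.

(** The last partial sums before the total are [sumn a] and [sumn b], so refinement forces
    [sumn b <= sumn a], that is [v <= c]. The case [v = c] is separate because a composition has no
    zero part. *)
Lemma comp_le_rcons a v b c :
  all (fun k => 0 < k) (rcons a v) -> all (fun k => 0 < k) (rcons b c) ->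
  sumn a + v = sumn b + c ->
  comp_le (rcons a v) (rcons b c) =
  (v <= c) && comp_le a (if v < c then rcons b (c - v) else b).
Proof.
move=> a0 b0 ab; have := a0; have := b0; rewrite !all_rcons => /andP[c0 b0'] /andP[v0 a0'].
have ab' : sumn (rcons a v) = sumn (rcons b c) by rewrite !sumn_rcons.
apply/(comp_leP a0 b0 ab')/andP => [H|[levc H] i].
  have levc : v <= c.
    have [|j] := H (size b); first by rewrite size_rcons.
    rewrite psum_rcons // psum_size size_rcons leq_eqVlt => /orP[/eqP->|ltj].
      rewrite -(size_rcons a v) psum_size sumn_rcons ab; lia.
    by rewrite psum_rcons // => sb; have := leq_psum_sumn a j; lia.
  have H' i : i <= size b -> exists2 j, j <= size a & psum b i = psum a j.
    move=> lei; have [|j] := H i; first by rewrite size_rcons ltnW.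
    rewrite psum_rcons // size_rcons leq_eqVlt => /orP[/eqP->|ltj].
      rewrite -(size_rcons a v) psum_size sumn_rcons.
      by have := leq_psum_sumn b i; lia.
    by rewrite psum_rcons // => E; exists j.
  split=> //; case: ltnP => [ltvc|lecv].
    apply/comp_leP => //; rewrite ?all_rcons ?subn_gt0 ?ltvc // ?sumn_rcons; first by lia.
    move=> i; rewrite size_rcons leq_eqVlt => /orP[/eqP->|lti].
      exists (size a) => //; rewrite -(size_rcons b (c - v)) !psum_size sumn_rcons; lia.
    by have [j lej E] := H' i lti; exists j; rewrite // psum_rcons.
  by apply/comp_leP => //; lia.
rewrite size_rcons leq_eqVlt => /orP[/eqP->|lti].
  by exists (size a).+1; rewrite ?size_rcons // -(size_rcons b c) -(size_rcons a v) !psum_size.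
suff [j lej E] : exists2 j, j <= size a & psum b i = psum a j.
  by exists j; rewrite ?size_rcons ?(ltnW lej) ?leqW // !psum_rcons.
move: H; case: ltnP => [ltvc|lecv] H.
  have /comp_leP H' := H.
  have [||||j lej E] := H' _ _ _ i; rewrite ?all_rcons ?subn_gt0 ?ltvc ?sumn_rcons ?size_rcons ?leqW //.
    by lia.
  by exists j; rewrite // -E psum_rcons.
have /comp_leP H' := H.
by apply: H' => //; lia.
Qed.

(** Only the parts inside the last block of the coarser composition change: they lose [v], and with
    it the last factor of their [pi_comp], which is the full sum [c] of the block. *)
Lemma pi_pair_rcons_rcons a v b c :
  all (fun k => 0 < k) (rcons a v) -> all (fun k => 0 < k) (rcons b c) ->
  sumn a + v = sumn b + c -> comp_le (rcons a v) (rcons b c) ->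
  pi_pair (rcons a v) (rcons b c) = c * pi_pair a (if v < c then rcons b (c - v) else b).
Proof.
move=> a0 b0 ab ab_le; have := a0; have := b0; rewrite !all_rcons => /andP[c0 b0'] /andP[v0 a0'].
have levc : v <= c by move: ab_le; rewrite comp_le_rcons // => /andP[].
have [i lei sumb] : exists2 i, i <= size a & sumn b = psum a i.
  have ab' : sumn (rcons a v) = sumn (rcons b c) by rewrite !sumn_rcons.
  have /(comp_leP a0 b0 ab')/(_ (size b))[|j] := ab_le; first by rewrite size_rcons.
  rewrite psum_rcons // psum_size size_rcons leq_eqVlt => /orP[/eqP->|ltj].
    rewrite -(size_rcons a v) psum_size sumn_rcons; lia.
  by rewrite psum_rcons // => ->; exists j.
(* If [v = c] the list of remaining parts is empty and its [pi_comp] is 1, so both branches take one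
   form. *)
have -> : pi_pair a (if v < c then rcons b (c - v) else b) =
    (\prod_(i < size b) pi_comp (restr a b i)) * pi_comp (parts_between a (sumn b) (sumn a)).
  case: ltnP => [ltvc|lecv].
    by rewrite pi_pair_rcons; congr (_ * pi_comp (parts_between _ _ _)); lia.
  have -> : sumn b = sumn a by lia.
  by rewrite parts_between_sumn_nil // /pi_comp big_ord0 muln1.
rewrite pi_pair_rcons parts_between_rcons -ab leqnn andbT (_ : sumn b <= sumn a); last by lia.
rewrite cats1 pi_comp_rcons parts_between_sumn ?leq_addr //.
rewrite (_ : sumn (parts_between a (sumn b) (sumn a)) + v = c); last first.
  by have := sumn_parts_between a0' lei; rewrite -sumb; lia.
rewrite [LHS]mulnA [LHS]mulnC; congr (_ * (_ * _)).
apply: eq_bigr => k _; congr pi_comp.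
rewrite -[LHS]/(parts_between _ _ _) parts_between_rcons.
rewrite [X in _ && X](_ : _ = false) ?andbF ?cats0 //.
by have := leq_psum_sumn b k.+1; lia.
Qed.

(** * Coefficients of [Psi_alpha / z_alpha] and their recursion *)

Local Open Scope ring_scope.

(* The coefficient of [x^e] in [Psi_a / z_a] when [sumn e = sumn a]. *)
Definition coefPsi_z (a e : seq nat) : rat :=
  let b := [seq x <- e | (0 < x)%N] in
  if comp_le a b then ((pi_pair a b)%:R)^-1 else 0.

Lemma filter_gt0_all e : all (fun k => 0 < k)%N [seq x <- e | (0 < x)%N].
Proof. exact: filter_all. Qed.

Lemma sumn_filter_gt0 e : sumn [seq x <- e | (0 < x)%N] = sumn e.
Proof. by elim: e => //= -[|x] e IH /=; rewrite IH. Qed.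

(** Only one [M_beta] contains the monomial, the one indexed by the nonzero exponents, and it occurs
    only in degree [n]. *)
Lemma coefPsiAE n a e :
  coefPsiA n a e = (zee a)%:R * (if sumn e == n then coefPsi_z a e else 0).
Proof.
rewrite /coefPsiA; congr (_ * _); set b := [seq x <- e | (0 < x)%N].
have F0 a' : is_comp n a' -> a' != b -> (if comp_le a a' then
    ((pi_pair a a')%:R)^-1 * (coefMon a' e)%:R else 0 : rat) = 0.
  by case/andP=> a0 _ /negPf nb; rewrite coefMonE // nb mulr0 if_same.
case: eqP => [sume|nsume].
  have cb : is_comp n b by rewrite /is_comp filter_gt0_all sumn_filter_gt0 sume eqxx.
  rewrite (sum_comps_pred1 cb F0) coefMonE ?filter_gt0_all // -/b eqxx mulr1.
  by [].
rewrite /sum_comps big1 // => k _; rewrite big1 // => t ct; apply: F0 => //.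
apply/eqP => tb; case/andP: ct => _; by rewrite tb sumn_filter_gt0 => /eqP.
Qed.

Lemma coefPsi_z_rcons0 a e : coefPsi_z a (rcons e 0) = coefPsi_z a e.
Proof. by rewrite /coefPsi_z filter_rcons. Qed.

(** The recursions for refinement and for [pi] combine. When [v = c] the new exponent is 0 and the
    filter drops it, so one formula covers both cases. *)
Lemma coefPsi_z_rcons a v e c :
  all (fun k => 0 < k)%N (rcons a v) -> (0 < c)%N -> (sumn a + v = sumn e + c)%N ->
  c%:R * coefPsi_z (rcons a v) (rcons e c) =
  if (v <= c)%N then coefPsi_z a (rcons e (c - v)%N) else 0.
Proof.
move=> a0 c0 ae; rewrite /coefPsi_z !filter_rcons c0 subn_gt0 /=.
set b := [seq x <- e | (0 < x)%N].
have bc0 : all (fun k => 0 < k)%N (rcons b c) by rewrite all_rcons c0 filter_gt0_all.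
have ab : (sumn a + v = sumn b + c)%N by rewrite sumn_filter_gt0.
have := comp_le_rcons a0 bc0 ab; have := pi_pair_rcons_rcons a0 bc0 ab.
case: (comp_le (rcons a v) _) => [/(_ isT) -> /esym/andP[-> ->]|_ /esym].
  by rewrite natrM invfM mulrA mulfV ?mul1r // pnatr_eq0 -lt0n.
by case: (v <= c)%N => [/= ->|_]; rewrite mulr0.
Qed.

(** The fibres partition [D]. With the positivity of starred fibre sizes, this lets sums run over
    all bounded sequences: only compositions of [#|D|] have a nonzero starred count. *)
Lemma fib_count_sumn (T : finType) (le : rel T) Q re (D : {set T}) :
  fib_count le Q re D != 0%N -> sumn re = #|D|.
Proof.
elim: re D => [|c r IH] D /=.
  by rewrite eqb0 negbK => /eqP->; rewrite cards0.
apply: contraNeq => nD; rewrite big1 // => U /and3P[/andP[UD _] /eqP cU _].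
apply: contraNeq nD => /IH ->; rewrite cardsDS // cU subnKC // -cU.
exact: subset_leq_card.
Qed.

Lemma fib_count_unique_min_pos (T : finType) (le : rel T) re (D : {set T}) :
  fib_count le (unique_min le) re D != 0%N -> all (fun k => 0 < k)%N re.
Proof.
elim: re D => // c r IH D /=.
apply: contraNT => ncr; rewrite big1 // => U /and3P[_ /eqP cU /eqP uU].
apply: contraNeq ncr => /IH ->; rewrite andbT -cU lt0n cards_eq0.
apply/eqP => U0; move: uU; rewrite U0 (_ : [set x in set0 | _] = set0) ?cards0 //.
by apply/setP=> x; rewrite !inE.
Qed.

(** * Comparison of the two recursions *)

Section Expansion.
Variables (T : finType) (le : rel T).
Hypotheses (le_refl : reflexive le) (le_anti : antisymmetric le) (le_trans : transitive le).
Implicit Types (D : {set T}).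

Let mincount a D := fib_count le (unique_min le) (rev a) D.

(** The induction is on [K], which bounds [#|D|]; the inner one on [e] strips trailing zero
    exponents. For a last exponent [c > 0], both sides times [c] become one sum over the [x] in [D]
    whose filter has at most [c] elements, each term being the statement for [D] without that
    filter. *)
Lemma fib_count_expansion N K D e : (#|D| <= K)%N -> (#|D| < N)%N -> sumn e = #|D| ->
  sum_seqs N K (fun a => coefPsi_z a e * (mincount a D)%:R) =
  (fib_count le predT (rev e) D)%:R.
Proof.
elim: K D e => [|K IHK] D; elim/last_ind => [|e c IHe] leK ltN.
- move=> /= /esym/eqP; rewrite cards_eq0 => D0.
  by rewrite addr0 /mincount /= D0 /coefPsi_z /= /pi_pair big_ord0 invr1 mulr1.
- rewrite sumn_rcons => sume; have c0 : c = 0%N by lia.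
  rewrite c0 rev_rcons fib_count_predT_0cons -IHe //; last by lia.
  by apply: eq_sum_seqs => a; rewrite coefPsi_z_rcons0.
- move=> /= /esym/eqP; rewrite cards_eq0 => D0.
  rewrite {1}/mincount /= D0 /coefPsi_z /= /pi_pair big_ord0 invr1 mulr1 big1 ?addr0 // => v _.
  apply: sum_seqs_eq0 => a; have [->|nz] := eqVneq (mincount (rcons a v) D) 0%N.
    by rewrite mulr0.
  have := fib_count_sumn nz; have := fib_count_unique_min_pos nz.
  by rewrite rev_rcons /= (eqP D0) cards0 => /andP[]; lia.
rewrite sumn_rcons => sume; have [c0|c0] := posnP c.
  rewrite c0 rev_rcons fib_count_predT_0cons -IHe //; last by lia.
  by apply: eq_sum_seqs => a; rewrite coefPsi_z_rcons0.
have nzc : c%:R != 0 :> rat by rewrite pnatr_eq0 -lt0n.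
apply: (mulfI nzc); rewrite rev_rcons -natrM mul_fib_count_predT_cons // natr_sum.
have D0 : (D == set0) = false by rewrite -cards_eq0; lia.
rewrite /= {1}/mincount /= D0 mulr0 add0r big_distrr /=.
have cardV x : x \in D -> (0 < #|pfilter le D x|)%N.
  by move=> xD; rewrite lt0n cards_eq0; apply/set0Pn; exists x; apply: pfilter_self.
have cardDV x : x \in D -> #|D :\: pfilter le D x| = (#|D| - #|pfilter le D x|)%N.
  by move=> xD; rewrite cardsDS //; case/andP: (upset_pfilter le_trans D x).
have cardVD x : (#|pfilter le D x| <= #|D|)%N.
  by apply: subset_leq_card; case/andP: (upset_pfilter le_trans D x).
transitivity (\sum_(v < N) \sum_(x in D | #|pfilter le D x| == v)
   if (v <= c)%N then (fib_count le predT ((c - v)%N :: rev e) (D :\: pfilter le D x))%:R else 0 : rat).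
  apply: eq_bigr => v _; rewrite -sum_seqsZ.
  pose F (x : T) (a : seq nat) : rat := if (v <= c)%N then
     coefPsi_z a (rcons e (c - v)%N) * (mincount a (D :\: pfilter le D x))%:R else 0.
  transitivity (sum_seqs N K (fun a => \sum_(x in D | #|pfilter le D x| == v) F x a)).
    apply: eq_sum_seqs => a; rewrite mulrA /mincount rev_rcons.
    rewrite fib_count_unique_min_cons // natr_sum big_distrr /=.
    apply: eq_bigr => x /andP[xD /eqP cv]; rewrite /F /mincount.
    (* [coefPsi_z_rcons] needs positive parts and matching totals; a nonzero starred count supplies
       both. *)
    have [->|nz] := eqVneq (fib_count le (unique_min le) (rev a) (D :\: pfilter le D x)) 0%N.
      by rewrite !mulr0 if_same.
    have := fib_count_sumn nz; have := fib_count_unique_min_pos nz.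
    rewrite sumn_rev all_rev cardDV // => a0 suma.
    rewrite coefPsi_z_rcons //; first by case: ifP => // _; rewrite mul0r.
      by rewrite all_rcons a0 -cv cardV.
    by have := cardVD x; lia.
  rewrite sum_seqs_sum; apply: eq_bigr => x /andP[xD /eqP cv]; rewrite /F.
  case: ifP => levc; last exact: sum_seqs_eq0.
  have := cardV x xD; have := cardVD x => leVD ltV.
  rewrite IHK ?rev_rcons //; rewrite ?sumn_rcons cardDV //; lia.
(* After the exchange, [x] determines [v] as the size of its filter, and the test [v <= c] becomes
   the condition on [x]. *)
rewrite (exchange_big_dep (mem D)) /=; last by move=> v x _ /andP[].
rewrite [RHS]big_mkcondr; apply: eq_bigr => x xD.
have ltvN : (#|pfilter le D x| < N)%N := leq_ltn_trans (cardVD x) ltN.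
rewrite (big_pred1 (Ordinal ltvN)) // => v.
by rewrite xD /= -val_eqE eq_sym.
Qed.

End Expansion.

Lemma zee_gt0 a : (0 < zee a)%N.
Proof.
rewrite /zee big_seq_cond; apply: prodn_cond_gt0 => i.
by rewrite mem_index_iota andbT => /andP[i0 _]; rewrite muln_gt0 expn_gt0 i0 fact_gt0.
Qed.

Local Close Scope ring_scope.

Theorem theorem4p2 (n : nat) (T : finType) (le : rel T) (w : T -> 'I_n)
  (le_refl : reflexive le) (le_anti : antisymmetric le)
  (le_trans : transitive le) (w_bij : bijective w)
  (w_nat : forall x y : T, le x y -> x != y -> w x < w y) :
  (forall e : seq nat,
     ((coefKP le e)%:R : rat) =
       sum_comps n (fun a => ((zee a)%:R)^-1 * coefPsiA n a e * (Lstar le w a)%:R)%R)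
  /\
  (exists c : seq nat -> rat,
     (forall a, is_comp n a -> (0 <= c a)%R) /\
     forall e : seq nat,
       ((coefKP le e)%:R : rat) = sum_comps n (fun a => c a * coefPsiA n a e)%R).
Proof.
have expansion (e : seq nat) : ((coefKP le e)%:R : rat) =
    sum_comps n (fun a => ((zee a)%:R)^-1 * coefPsiA n a e * (Lstar le w a)%:R)%R.
  have cardT : #|[set: T]| = n by rewrite cardsT (bij_eq_card w_bij) card_ord.
  have zK a x : ((zee a)%:R^-1 * ((zee a)%:R * x) = x :> rat)%R.
    by rewrite mulKf // pnatr_eq0 -lt0n zee_gt0.
  rewrite coefKP_fib_count (sum_comps_seqs (N := n.+1)) //.
  (* In a degree other than [n] both sides vanish. *)
  case: (eqVneq (sumn e) n) => [sume|nsume]; last first.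
    rewrite sum_seqs_eq0 => [|a]; last first.
      by rewrite coefPsiAE (negPf nsume) !(mulr0, mul0r) if_same.
    have [->//|nz] := eqVneq (fib_count le predT (rev e) setT) 0.
    by case/eqP: nsume; rewrite -sumn_rev (fib_count_sumn nz).
  rewrite -(fib_count_expansion le_refl le_anti le_trans (N := n.+1) (K := n)) ?cardT //.
  apply: eq_sum_seqs => a; rewrite coefPsiAE sume eqxx zK.
  case: ifP => [ca|/negbT nca].
    by rewrite (Lstar_fib_count le_refl le_anti le_trans w_bij w_nat ca).
  (* A sequence that is no composition of [n] has starred count zero, so both summands are zero. *)
  have [->|nz] := eqVneq (fib_count le (unique_min le) (rev a) setT) 0; first by rewrite mulr0.
  case/negP: nca; rewrite /is_comp -all_rev (fib_count_unique_min_pos nz).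
  by rewrite -sumn_rev (fib_count_sumn nz) cardT eqxx.
split=> //; exists (fun a => (Lstar le w a)%:R / (zee a)%:R)%R; split=> [a _|e].
  by rewrite divr_ge0 ?ler0n.
rewrite expansion; apply: eq_bigr => k _; apply: eq_bigr => t _.
by rewrite [LHS]mulrC mulrA.
Qed.
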